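(* For every integer $d\geq 2$ there are a constant $C_H^d>0$ depending only on $d$, and a family of $d$-hypertribe functions $H_n^d\colon\{-1,1\}^n\to\{-1,1\}$, with one member for every sufficiently large $n$ such that $k(n) = d\log_2\frac{n}{\log_2 n}$ is an integer (in particular for every sufficiently large $n$ of the form $n=2^{2^a}$, $a$ a positive integer), such that for every $n$ in the index set of the family and every $I\subseteq [n]$ with $|I|=d$, $$\mathrm{Inf}_I(H_n^d) \;\leq\; \mathrm{JInf}_I(H_n^d) \;\leq\; C_H^d\, \mathbf{W}^{\geq d}(H_n^d)\left(\frac{\log_2 n}{n}\right)^d .$$
   Context: $[n]=\{1,\dots,n\}$; $\mu_n$ is the uniform probability measure on $\{-1,1\}^n$, and $\mathbf{x}$ denotes a random point with law $\mu_n$. For $J \subseteq [n]$ let $\chi_J(x) = \prod_{j\in J} x_j$ (with $\chi_\varnothing = 1$); every $f\colon\{-1,1\}^n\to\mathbb{R}$ has a unique expansion $f=\sum_{J\subseteq [n]} \hat f(J)\chi_J$. Fourier weight: $\mathbf{W}^{\geq d}(f) = \sum_{|J|\geq d} \hat f(J)^2$. T-influence: $\mathrm{Inf}_I(f) = \sum_{J \supseteq I} \hat f(J)^2$. Joint influence: let $y^{\oplus i}$ be $y$ with its $i$-th coordinate negated. For non-empty $I\subseteq [n]$, an index $i\in I$ is $I$-pivotal for $f$ on input $x$ if there is $y\in\{-1,1\}^n$ agreeing with $x$ on all coordinates in $[n]\setminus I$ such that $f(y)\neq f(y^{\oplus i})$. Then $\mathrm{JInf}_I(f) = \mathbb{P}_{\mathbf{x}\sim\mu_n}(\text{every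 } i\in I \text{ is } I\text{-pivotal for } f \text{ on input } \mathbf{x})$. $d$-hypertribe functions: fix $d\geq2$ and put $k(n)=d\log_2\frac{n}{\log_2 n}$. Let $n$ be such that $k=k(n)$ is an integer with $k\leq\frac12\sqrt n$, and let $\mathcal{F}_n$ be a family of $k$-element subsets of $[n]$ (called tribes) such that (i) for at least half of the $d$-element sets $I\subseteq[n]$ there is $A\in\mathcal{F}_n$ with $I\subseteq A$; and (ii) for every $d$-element set $I\subseteq [n]$ there is at most one $A\in\mathcal{F}_n$ with $I\subseteq A$. (By a theorem of Kuzjurin such a family exists for every sufficiently large $n$ with $k(n)$ an integer.) The associated $d$-hypertribe function is defined by $H_n^d(x)=+1$ if there is $A\in\mathcal{F}_n$ with $x_i=1$ for all $i\in A$, and $H_n^d(x)=-1$ otherwise. *)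

(* Defs.v *)
From HB Require Import structures.
From mathcomp Require Import all_boot all_order all_algebra.
From mathcomp Require Import all_classical all_reals all_analysis.

Set Implicit Arguments.
Unset Strict Implicit.
Unset Printing Implicit Defensive.
Import Order.TTheory GRing.Theory Num.Theory.
Local Open Scope ring_scope.

(* A point of {-1,1}^n is stored as its vector of signs, with the sign
   convention of (-1) ^+ b: [false] stands for +1 and [true] for -1. *)
Definition cube (n : nat) : finType := {ffun 'I_n -> bool}.

Section CubeFunctions.
Variables (R : realType) (n : nat).
Implicit Types (f : cube n -> R) (x y : cube n) (I J : {set 'I_n}) (i : 'I_n).

Definition coord x i : R := (-1) ^+ (x i : bool).

Definition flip x i : cube n := [ffun j => if j == i then ~~ x j else x j].

Lemma coord_flip x i j :
  coord (flip x i) j = if j == i then - coord x j else coord x j.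
Proof. by rewrite /coord ffunE; case: eqP => // _; rewrite signrN. Qed.

Definition mu (E : {set cube n}) : R := #|E|%:R / #|{: cube n}|%:R.

Definition chi J x : R := \prod_(j in J) coord x j.

Definition is_fourier_expansion f (c : {ffun {set 'I_n} -> R}) : Prop :=
  forall x, f x = \sum_(J : {set 'I_n}) c J * chi J x.

(* The family of coefficients of the expansion of f; it exists and is unique
   by [fourier_expansionP] and [fourier_expansion_unique] below. *)
Definition fourier f : {ffun {set 'I_n} -> R} :=
  xget [ffun=> 0] (is_fourier_expansion f).

Lemma chiE J x : chi J x = \prod_i (if i \in J then coord x i else 1).
Proof. by rewrite /chi big_mkcond. Qed.

Lemma sum_chi_points J K :
  \sum_x chi J x * chi K x = (J == K)%:R * (2 ^ n)%:R.
Proof.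
pose F (i : 'I_n) (b : bool) : R :=
  (if i \in J then (-1) ^+ b else 1) * (if i \in K then (-1) ^+ b else 1).
have -> : \sum_x chi J x * chi K x = \sum_(x : cube n) \prod_i F i (x i).
  by apply: eq_bigr => x _; rewrite !chiE -big_split.
rewrite -(bigA_distr_bigA F).
have FE i : \sum_b F i b = ((i \in J) == (i \in K))%:R * 2.
  rewrite /F big_bool /= expr1 expr0.
  case: (i \in J); case: (i \in K) => /=;
    by rewrite ?(mulr1, mul1r, mulN1r, opprK, addNr, mul0r).
under eq_bigr do rewrite FE.
rewrite big_split /= prodr_const card_ord natrX; congr (_ * _).
case: eqP => [->|/eqP neqJK]; first by rewrite big1 // => i _; rewrite eqxx.
have [i neqi] : exists i, (i \in J) != (i \in K).
  apply/existsP; apply: contraNT neqJK; rewrite negb_exists => /forallP eqJK.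
  by apply/eqP/setP => i; apply/eqP; rewrite -[_ == _]negbK.
by rewrite (bigD1 i) //= (negbTE neqi) mul0r.
Qed.

Lemma sum_chi_sets x y :
  \sum_(J : {set 'I_n}) chi J x * chi J y = (x == y)%:R * (2 ^ n)%:R.
Proof.
transitivity (\prod_i (coord x i * coord y i + 1)).
  rewrite bigA_distr; apply: eq_bigr => J _; rewrite !chiE -big_split /=.
  by apply: eq_bigr => i _; case: ifP => // _; rewrite mulr1.
have E i : coord x i * coord y i + 1 = (x i == y i)%:R * 2.
  rewrite /coord; case: (x i); case: (y i) => /=;
    by rewrite ?(expr1, expr0, mulr1, mul1r, mulN1r, opprK, addNr, mul0r).
under eq_bigr do rewrite E.
rewrite big_split /= prodr_const card_ord natrX; congr (_ * _).
case: eqP => [->|/eqP neqxy]; first by rewrite big1 // => i _; rewrite eqxx.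
have [i neqi] : exists i, x i != y i.
  apply/existsP; apply: contraNT neqxy; rewrite negb_exists => /forallP eqxy.
  by apply/eqP/ffunP => i; apply/eqP; rewrite -[_ == _]negbK.
by rewrite (bigD1 i) //= (negbTE neqi) mul0r.
Qed.

Let pow2_neq0 : (2 ^ n)%:R != 0 :> R.
Proof. by rewrite pnatr_eq0 expn_eq0. Qed.

Lemma fourier_expansion_coef f c : is_fourier_expansion f c ->
  forall J, c J = (\sum_x f x * chi J x) / (2 ^ n)%:R.
Proof.
move=> fE J; apply: (canRL (mulfK pow2_neq0)).
under eq_bigr do rewrite fE big_distrl /=.
rewrite exchange_big /= (bigD1 J) //= [X in _ + X]big1 ?addr0 => [|K neqKJ].
  under eq_bigr do rewrite -mulrA.
  by rewrite -big_distrr /= sum_chi_points eqxx mul1r.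
under eq_bigr do rewrite -mulrA.
by rewrite -big_distrr /= sum_chi_points (negbTE neqKJ) mul0r mulr0.
Qed.

Lemma fourier_expansion_unique f c1 c2 :
  is_fourier_expansion f c1 -> is_fourier_expansion f c2 -> c1 = c2.
Proof.
by move=> h1 h2; apply/ffunP => J; rewrite !(@fourier_expansion_coef f).
Qed.

Lemma fourier_expansionP f : is_fourier_expansion f (fourier f).
Proof.
rewrite /fourier; case: xgetP => [c _ //|/(_ _)/= noexp].
pose c : {ffun {set 'I_n} -> R} :=
  [ffun J => (\sum_x f x * chi J x) / (2 ^ n)%:R].
case: (noexp c) => x; apply: (mulIf pow2_neq0); rewrite big_distrl /=.
under eq_bigr do rewrite ffunE mulrAC mulfVK // big_distrl /=.
rewrite exchange_big /= (bigD1 x) //= [X in _ + X]big1 ?addr0 => [|y neqyx].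
  under eq_bigr do rewrite -mulrA.
  by rewrite -big_distrr /= sum_chi_sets eqxx mul1r.
under eq_bigr do rewrite -mulrA.
by rewrite -big_distrr /= sum_chi_sets (negbTE neqyx) mul0r mulr0.
Qed.

Lemma fourierE f J : fourier f J = (\sum_x f x * chi J x) / (2 ^ n)%:R.
Proof. exact/fourier_expansion_coef/fourier_expansionP. Qed.

Definition weight_ge (d : nat) f : R :=
  \sum_(J : {set 'I_n} | (d <= #|J|)%N) fourier f J ^+ 2.

Definition Inf I f : R := \sum_(J : {set 'I_n} | I \subset J) fourier f J ^+ 2.

(* i is I-pivotal for f on input x (meant for i in I). *)
Definition pivotal I f x i : bool :=
  [exists y : cube n,
     [forall j in ~: I, y j == x j] && (f y != f (flip y i))].

Definition JInf I f : R := mu [set x | [forall i in I, pivotal I f x i]].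

Definition hypertribe (F : {set {set 'I_n}}) : cube n -> R :=
  fun x => if [exists A in F, [forall i in A, coord x i == 1]] then 1 else -1.

End CubeFunctions.

Arguments mu {R n} E.
Arguments coord {R n} x i.

Definition log2 (R : realType) (x : R) : R := ln x / ln 2.

Definition tribe_size (R : realType) (d n : nat) : R :=
  d%:R * log2 (n%:R / log2 n%:R).

Definition is_tribe_family (R : realType) (d n : nat)
    (F : {set {set 'I_n}}) : Prop :=
  exists k : nat,
    [/\ k%:R = tribe_size R d n,
        k%:R <= 2^-1 * Num.sqrt (n%:R : R),
        forall A, A \in F -> #|A| = k,
        (#|[set I : {set 'I_n} | #|I| == d]| <=
           2 * #|[set I : {set 'I_n} |
                   (#|I| == d) && [exists A in F, I \subset A]]|)%N
      & forall I : {set 'I_n}, #|I| = d ->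
          (#|[set A in F | I \subset A]| <= 1)%N].

Definition is_hypertribe_function (R : realType) (d n : nat)
    (f : cube n -> R) : Prop :=
  exists F : {set {set 'I_n}}, is_tribe_family R d F /\ f =1 hypertribe R F.

Definition in_index_set (R : realType) (d n0 n : nat) : Prop :=
  (n0 <= n)%N /\ tribe_size R d n \is a Num.int.

(* Main.v *)
Require Import Defs.
From mathcomp Require Import all_boot all_order all_algebra all_field.
From mathcomp Require Import all_classical all_reals all_analysis.
From mathcomp Require Import ring lra zify.
From mathcomp Require Import fintype finset.
Import Order.TTheory GRing.Theory Num.Theory.
Local Open Scope ring_scope.

Set Implicit Arguments.
Unset Strict Implicit.
Unset Printing Implicit Defensive.

(** Write L = log2 n / n, so that the tribe size k satisfies 2^-k = L^d.

    Existence of the tribes.  Since k is only of order log n, no asymptotic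
    existence theorem for packings is needed: a transversal design is enough.
    Split k * q of the points of [n] into k groups of size q, and let the tribes
    be the graphs of the words of a maximum distance separable code of length k
    with q^d words over an alphabet of size q.  Two words agree in fewer than d
    positions, so a d-set lies in at most one tribe, and q^d C(k, d) d-sets are
    covered ([card_covered]).  As k tends to infinity this is at least half of
    all d-sets as soon as k * q is close enough to n.  Reed-Solomon codes need q
    to be a prime power, but the product of two codes is again a code
    ([mds_code_prod]), so q = 2^a 3^b with 2^a, 3^b >= k is allowed; the
    ratios of consecutive numbers of this form tend to 1, because a ratio of
    a power of 2 and a power of 3 can be made arbitrarily close to 1 without being
    equal to it ([approx_powers], [smooth_approx]).

    Upper bound on the joint influence.  If i is J-pivotal then i belongs to
    a tribe all of whose coordinates outside J are +1.  At most q^(d-s) tribes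
    contain a given s-set, each is satisfied with probability L^d, and
    q * L <= 1; exploring the tribes one at a time ([off_event_le]) yields
    JInf_J(H) = O(L^|J|) for every |J| <= d.

    Lower bound on the weight.  For a function with values in {-1, 1} both
    Inf_J(f) and |hat f(J)| are at most JInf_J(f), because the part of f carried
    by the characters chi_K with K containing J is bounded by 1 and vanishes at
    the inputs where some i in J is not pivotal ([laplacian_le_pivotal]).  Hence
    the levels 1, ..., d - 1 of H contribute O(n L^2), which tends to 0.  The
    expected number lambda = (q L)^d of satisfied tribes is bounded below and at
    most 1/2, so by a Bonferroni inequality P(H = 1) is between lambda / 2 and
    1 / 2; thus the variance of H is at least lambda, and the weight above level
    d stays bounded away from 0 ([weight_hypertribe_ge]).  For
    |I| = d the bound JInf_I(H) = O(L^d) is therefore the one claimed. *)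

Local Open Scope nat_scope.

(** * Numbers 2^a 3^b just below a given bound *)

(** With x = Y / X and y = (Q Y) / (P X) both at least 1, and N (x - 1), N (y - 1)
    having the same integer part b, the ratio y / x = Q / P lies between
    N / (N + 1) and (N + 1) / N. *)
Lemma same_box_ratio N b P Q X Y : 0 < Y -> X <= Y -> P * X <= Q * Y ->
    b * X <= N * (Y - X) < b.+1 * X ->
    b * (P * X) <= N * (Q * Y - P * X) < b.+1 * (P * X) ->
  N * Q <= N.+1 * P /\ N * P <= N.+1 * Q.
Proof.
move=> Y0 Fi Fj; rewrite !mulnBr !leq_subRL ?ltn_subLR ?leq_mul2l ?Fi ?Fj ?orbT //.
move=> /andP[Bi1 Bi2] /andP[Bj1 Bj2].
split; rewrite -(leq_pmul2r Y0).
  have : P * (N * X + b * X) <= P * (N * Y) by rewrite leq_mul2l Bi1 orbT.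
  have : P * X <= P * Y by rewrite leq_mul2l Fi orbT.
  by lia.
have : P * (N * Y) <= P * (N * X + b.+1 * X) by rewrite leq_mul2l ltnW ?orbT.
by lia.
Qed.

(** By the pigeonhole principle applied to the numbers 3^i / 2^f(i) in [1, 2),
    0 <= i <= N: two of them are at distance less than 1 / N.  The ratio of the
    two is p^t / r^s or its inverse, where {p, r} = {2, 3}. *)
Lemma approx_powers N : (0 < N)%N -> exists p r s t : nat,
  [/\ (p, r) = (2, 3) \/ (p, r) = (3, 2), r ^ s < p ^ t
    & N * p ^ t <= N.+1 * r ^ s].
Proof.
move=> N0; pose f i := trunc_log 2 (3 ^ i).
have fb i : 2 ^ f i <= 3 ^ i < 2 ^ (f i).+1.
  by apply: trunc_log_bounds => //; rewrite expn_gt0.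
have box_lt (i : 'I_N.+1) : N * (3 ^ i - 2 ^ f i) %/ 2 ^ f i < N.
  rewrite ltn_divLR ?expn_gt0 // ltn_pmul2l //.
  by have := fb i; rewrite expnS; lia.
pose box i := Ordinal (box_lt i).
have /injectivePn [i [j neq_ij eq_box]] : ~~ injectiveb box.
  apply/negP => /injectiveP /leq_card; rewrite !card_ord; lia.
wlog lt_ij : i j neq_ij eq_box / i < j.
  move=> W; case: (ltngtP i j) => [||/val_inj e]; last by rewrite e eqxx in neq_ij.
    exact: W.
  by apply: W; rewrite // eq_sym.
have le_f : f i <= f j by apply: leq_trunc_log; rewrite leq_exp2l // ltnW.
have gt0 e : 0 < 2 ^ e by rewrite expn_gt0.
have {eq_box} eq_box := congr1 val eq_box; rewrite /= in eq_box.
have := fb i; have := fb j; rewrite !expnS.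
have bound m x : 0 < x -> m %/ x * x <= m < (m %/ x).+1 * x.
  by move=> x0; rewrite leq_divM ltn_ceil.
have := bound (N * (3 ^ j - 2 ^ f j)) _ (gt0 (f j)).
have := bound (N * (3 ^ i - 2 ^ f i)) _ (gt0 (f i)).
rewrite -eq_box; set b := (_ %/ _).
have -> : 3 ^ j = 3 ^ (j - i) * 3 ^ i by rewrite -expnD subnK // ltnW.
have -> : 2 ^ f j = 2 ^ (f j - f i) * 2 ^ f i by rewrite -expnD subnK.
have := gt0 (f i); have : 0 < 3 ^ i by rewrite expn_gt0.
have := gt0 (f j - f i); have : 0 < 3 ^ (j - i) by rewrite expn_gt0.
have neqP : 2 ^ (f j - f i) <> 3 ^ (j - i).
  (* a power of 2 that is odd is 1 *)
  move=> e; have : odd (3 ^ (j - i)) by rewrite oddX orbT.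
  rewrite -e oddX /= orbF => /eqP e0; rewrite e0 expn0 in e.
  have : 1 < 3 ^ (j - i) by rewrite -{1}(expn0 3) ltn_exp2l // subn_gt0.
  by rewrite -e.
move=> Q0 P0 Y0 X0 Bi Bj /andP[Fj _] /andP[Fi _].
have [leQP lePQ] := same_box_ratio Y0 Fi Fj Bi Bj.
case: (ltngtP (2 ^ (f j - f i)) (3 ^ (j - i))) => // lt_pow.
  by exists 3, 2, (f j - f i), (j - i); split; [right | |].
by exists 2, 3, (j - i), (f j - f i); split; [left | |].
Qed.

(** If n is large compared with k^3, there is q = 2^a 3^b with both factors at
    least k, k * q <= n and n <= (1 + 1 / N) k * q. *)
Lemma smooth_approx N : 0 < N -> exists M, forall k n, 0 < k -> M * k ^ 3 <= n ->
  exists a b, [/\ k <= 2 ^ a, k <= 3 ^ b, k * (2 ^ a * 3 ^ b) <= n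
    & N * n <= N.+1 * (k * (2 ^ a * 3 ^ b))].
Proof.
move=> N0; have [p [r [s [t [prE lt_rp le_pr]]]]] := approx_powers N0.
suff [M HM] : exists M, forall k n, 0 < k -> M * k ^ 3 <= n ->
  exists a b, [/\ k <= r ^ a, k <= p ^ b, k * (r ^ a * p ^ b) <= n
    & N * n <= N.+1 * (k * (r ^ a * p ^ b))].
  exists M => k n k0 /(HM _ _ k0)[a [b]].
  case: prE => -[-> ->] [ka kb le_n ge_n]; last by exists a, b.
  by exists b, a; rewrite (mulnC (2 ^ b)).
have [p1 r1 p3 r3] : [/\ 1 < p, 1 < r, p <= 3 & r <= 3].
  by case: prE => -[-> ->].
have rgt0 e : 0 < r ^ e by rewrite expn_gt0 ltnW.
have pgt0 e : 0 < p ^ e by rewrite expn_gt0 ltnW.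
(* the ratio p ^ t / r ^ s exceeds 1, so its powers pass r *)
have [J HJ] : exists J, r * (r ^ s) ^ J <= (p ^ t) ^ J.
  have bern J : (r ^ s) ^ J.+1 + J.+1 * (r ^ s) ^ J <= (p ^ t) ^ J.+1.
    elim: J => [|J IH]; first by rewrite !expn1 expn0 mul1n addn1.
    rewrite expnS [X in _ <= X]expnS.
    apply: leq_trans (leq_mul lt_rp IH).
    rewrite [in X in X + _]expnS; move: (r ^ s) => u.
    by rewrite !expnS; move: (u ^ J) => v; nia.
  exists (r * r ^ s).+1; apply: leq_trans (bern _).
  by rewrite [(r ^ s) ^ _.+1]expnS; move: (_ ^ (r * r ^ s)) => w; nia.
have sJ j : j <= J -> s * j <= s * J by move=> lej; rewrite leq_mul2l lej orbT.
exists (9 * r ^ (s * J)) => k n k0 le_n.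
(* r ^ A * p ^ B is the initial value of q: p ^ B and r ^ A0 are the first powers
   above k, and A is as large as possible *)
pose B := (trunc_log p k).+1; pose A0 := (trunc_log r k).+1.
have kB : k <= p ^ B by rewrite ltnW // trunc_log_ltn.
have kA : k <= r ^ A0 by rewrite ltnW // trunc_log_ltn.
have BK : p ^ B <= 3 * k.
  by rewrite expnS leq_mul // trunc_logP.
have AK : r ^ A0 <= 3 * k.
  by rewrite expnS leq_mul // trunc_logP.
pose m := n %/ (k * p ^ B); pose A := trunc_log r m.
have kp0 : 0 < k * p ^ B by rewrite muln_gt0 k0 pgt0.
have le_m : r ^ (A0 + s * J) <= m.
  rewrite leq_divRL // expnD; apply: leq_trans le_n.
  have -> : 9 * r ^ (s * J) * k ^ 3 = 3 * k * (3 * k) * (r ^ (s * J) * k).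
    by rewrite !expnS expn0; lia.
  have -> : r ^ A0 * r ^ (s * J) * (k * p ^ B) =
      r ^ A0 * p ^ B * (r ^ (s * J) * k).
    by rewrite [k * _]mulnC mulnACA.
  by rewrite leq_mul // leq_mul.
have le_A : A0 + s * J <= A by exact: trunc_log_max.
have m0 : 0 < m by apply: leq_trans le_m.
have /andP[leA ltA] := trunc_log_bounds r1 m0; rewrite -/A in leA ltA.
(* each step multiplies q by p ^ t / r ^ s, a factor between 1 and 1 + 1 / N; the
   bound n is passed before step J, while the exponent of r is still at least A0 *)
pose q j := r ^ (A - s * j) * p ^ (B + t * j).
have qS j : j < J -> q j.+1 * r ^ s = q j * p ^ t.
  move=> ltj; rewrite /q !mulnS mulnAC -expnD -[RHS]mulnA -expnD.
  congr (r ^ _ * p ^ _); last by lia.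
  by have := sJ _ ltj; rewrite mulnS; lia.
have q0 : k * q 0 <= n.
  by rewrite /q !muln0 subn0 addn0 mulnCA -leq_divRL.
have qJ : n < k * q J.
  have lt_n : n < r ^ A.+1 * (k * p ^ B) by rewrite -ltn_divLR.
  rewrite -(ltn_pmul2r (rgt0 (s * J))) in lt_n.
  rewrite -(ltn_pmul2r (rgt0 (s * J))); apply: leq_trans lt_n _.
  have -> : r ^ A.+1 = r ^ (A - s * J) * (r * r ^ (s * J)).
    by rewrite -expnS -expnD; congr (_ ^ _); lia.
  rewrite /q expnD.
  have -> : k * (r ^ (A - s * J) * (p ^ B * p ^ (t * J))) * r ^ (s * J) =
    r ^ (A - s * J) * r ^ (s * J) * (k * p ^ B) * p ^ (t * J) by lia.
  have -> : r ^ (A - s * J) * (r * r ^ (s * J)) * (k * p ^ B) * r ^ (s * J) =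
    r ^ (A - s * J) * r ^ (s * J) * (k * p ^ B) * (r * r ^ (s * J)) by lia.
  by rewrite leq_mul2l !expnM HJ orbT.
have [|j] := ex_minnP (P := fun j => n < k * q j); first by exists J.
case: j => [|j]; first by rewrite ltnNge q0.
move=> ltj /(_ _)Hmin.
have ltjJ : j < J by apply: Hmin.
exists (A - s * j), (B + t * j); split.
- by apply: leq_trans kA _; have := sJ _ (ltnW ltjJ); rewrite leq_exp2l //; lia.
- by rewrite (leq_trans kB) // leq_exp2l // leq_addr.
- by rewrite leqNgt; apply/negP => /Hmin; rewrite ltnn.
rewrite -/(q j) -(leq_pmul2r (rgt0 s)).
apply: (@leq_trans (N * (k * q j.+1) * r ^ s)).
  by rewrite leq_mul2r leq_mul2l (ltnW ltj) !orbT.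
have -> : N * (k * q j.+1) * r ^ s = N * k * (q j.+1 * r ^ s) by rewrite !mulnA.
rewrite qS //; move: (q j) => v.
have -> : N * k * (v * p ^ t) = k * v * (N * p ^ t) by lia.
have -> : N.+1 * (k * v) * r ^ s = k * v * (N.+1 * r ^ s) by lia.
by rewrite leq_mul2l le_pr orbT.
Qed.

(** * Maximum distance separable codes *)

(** The set of positions at which two words coincide. *)
Definition agree (I T : finType) (c1 c2 : {ffun I -> T}) : {set I} :=
  [set i | c1 i == c2 i].

(** A maximum distance separable code of length k and dimension d over the
    alphabet T: it has #|T| ^ d words, and two distinct words agree in fewer than
    d positions. *)
Definition mds_code (T : finType) k d (G : {set {ffun 'I_k -> T}}) :=
  #|G| = #|T| ^ d /\
  forall c1 c2, c1 \in G -> c2 \in G -> c1 != c2 -> #|agree c1 c2| < d.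

(** The words are the values of the polynomials of degree less than d at k fixed
    distinct points of the field. *)
Lemma reed_solomon (K : finFieldType) k d : d <= k -> k <= #|K| ->
  exists G : {set {ffun 'I_k -> K}}, mds_code d G.
Proof.
move=> le_dk le_kK.
pose pt (i : 'I_k) : K := enum_val (widen_ord le_kK i).
have pt_inj : injective pt by move=> i j /enum_val_inj/(congr1 val)/= /val_inj.
pose enc (u : 'rV[K]_d) : {ffun 'I_k -> K} := [ffun i => (rVpoly u).[pt i]%R].
have enc_agree u v : u != v -> #|agree (enc u) (enc v)| < d.
  move=> neq_uv; pose w := rVpoly (u - v)%R.
  have w0 : w != 0%R.
    apply: contraNneq neq_uv => w0.
    by rewrite -subr_eq0 -[(u - v)%R]rVpolyK -/w w0 linear0.
  have le_w : size w <= d by rewrite size_poly.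
  rewrite (leq_trans _ le_w) // cardE -(size_map pt) max_poly_roots //.
    apply/allP => z /mapP[i]; rewrite mem_enum inE !ffunE => /eqP e {z}->.
    by rewrite /root /w linearB hornerD hornerN e subrr.
  by rewrite map_inj_uniq ?enum_uniq.
have enc_inj : injective enc.
  move=> u v e; apply/eqP; apply: contraTT le_dk => /enc_agree.
  rewrite e -ltnNge (_ : agree _ _ = setT) ?cardsT ?card_ord //.
  by apply/setP => i; rewrite !inE eqxx.
exists [set enc u | u in setT]; split.
  by rewrite card_imset // cardsT card_mx mul1n.
move=> _ _ /imsetP[u _ ->] /imsetP[v _ ->] neq; apply: enc_agree.
by apply: contraNneq neq => ->.
Qed.

Lemma mds_code_prod (T1 T2 : finType) k d (G1 : {set {ffun 'I_k -> T1}})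
    (G2 : {set {ffun 'I_k -> T2}}) :
    mds_code d G1 -> mds_code d G2 ->
  exists G : {set {ffun 'I_k -> T1 * T2}}, mds_code d G.
Proof.
move=> [card1 agr1] [card2 agr2].
pose pr (c : {ffun 'I_k -> T1} * {ffun 'I_k -> T2}) : {ffun 'I_k -> T1 * T2} :=
  [ffun i => (c.1 i, c.2 i)].
have pr_inj : injective pr.
  move=> [a b] [a' b'] /ffunP e; congr pair; apply/ffunP => i;
    by have := e i; rewrite !ffunE => -[].
exists (pr @: setX G1 G2); split.
  by rewrite card_imset // cardsX card1 card2 card_prod expnMn.
move=> _ _ /imsetP[[a b] /setXP[/= a1 b2] ->] /imsetP[[a' b'] /setXP[/= a1' b2'] ->].
have [<-{a' a1'}|neq _] := eqVneq a a'.
  have [<-|neq _] := eqVneq b b'; first by rewrite eqxx.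
  apply: leq_ltn_trans (agr2 _ _ b2 b2' neq); apply: subset_leq_card.
  by apply/subsetP => i; rewrite !inE !ffunE => /andP[].
apply: leq_ltn_trans (agr1 _ _ a1 a1' neq); apply: subset_leq_card.
by apply/subsetP => i; rewrite !inE !ffunE => /andP[].
Qed.

Lemma exists_mds_code k d a b : 1 < k -> d <= k -> k <= 2 ^ a -> k <= 3 ^ b ->
  exists (T : finType) (G : {set {ffun 'I_k -> T}}),
    #|T| = 2 ^ a * 3 ^ b /\ mds_code d G.
Proof.
move=> k1 le_dk ka kb.
have a0 : 0 < a by case: a ka => //; rewrite expn0; lia.
have b0 : 0 < b by case: b kb => //; rewrite expn0; lia.
have [K2 _ card2] := pPrimePowerField (isT : prime 2) a0.
have [K3 _ card3] := pPrimePowerField (isT : prime 3) b0.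
have [|G2 mds2] := @reed_solomon K2 k d le_dk; first by rewrite card2.
have [|G3 mds3] := @reed_solomon K3 k d le_dk; first by rewrite card3.
have [G mds] := mds_code_prod mds2 mds3.
by exists (K2 * K3)%type, G; rewrite card_prod card2 card3.
Qed.

(** * Partial designs *)

(** The properties of a family of tribes used below: q ^ d blocks of size k, two
    blocks meeting in fewer than d points, and at most q ^ (d - s) blocks through
    an s-set when s <= d. *)
Definition partial_design n (k d q : nat) (F : {set {set 'I_n}}) :=
  [/\ forall A, A \in F -> #|A| = k,
      #|F| = q ^ d,
      forall A B, A \in F -> B \in F -> A != B -> #|A :&: B| < d
    & forall S : {set 'I_n}, #|S| <= d ->
        #|[set A in F | S \subset A]| <= q ^ (d - #|S|)].

(** Place k disjoint copies of the alphabet in [n]; the blocks are the graphs of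
    the words. *)
Lemma design_of_code (T : finType) k d n (G : {set {ffun 'I_k -> T}}) :
    mds_code d G -> 0 < #|T| -> d <= k -> k * #|T| <= n ->
  exists F : {set {set 'I_n}}, partial_design k d #|T| F.
Proof.
move=> [cardG agrG] /card_gt0P[t0 _] le_dk le_n.
have le_kT : #|{: 'I_k * T}| <= n by rewrite card_prod card_ord.
pose phi (z : 'I_k * T) : 'I_n := widen_ord le_kT (enum_rank z).
have phi_inj : injective phi.
  by move=> y z /(congr1 val)/= /val_inj/enum_rank_inj.
pose block (c : {ffun 'I_k -> T}) : {set 'I_n} := [set phi (i, c i) | i : 'I_k].
have blockE c i t : (phi (i, t) \in block c) = (c i == t).
  apply/imsetP/eqP => [[j _ /phi_inj[-> ->]] //|<-]; by exists i.
have card_block c : #|block c| = k.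
  by rewrite card_imset ?card_ord // => i j /phi_inj[].
have blockI c1 c2 : block c1 :&: block c2 = [set phi (i, c1 i) | i in agree c1 c2].
  apply/setP => x; rewrite inE; apply/andP/imsetP => [[/imsetP[i _ ->]]|[i]].
    by rewrite blockE => e; exists i; rewrite // inE eq_sym.
  by rewrite inE => /eqP e ->; rewrite !blockE e.
have card_blockI c1 c2 : #|block c1 :&: block c2| = #|agree c1 c2|.
  by rewrite blockI card_imset // => i j /phi_inj[].
have block_inj : injective block.
  move=> c1 c2 e; apply/ffunP => i; apply/esym/eqP.
  by rewrite -(blockE c2) -e blockE.
exists [set block c | c in G]; split.
- by move=> _ /imsetP[c _ ->].
- by rewrite card_imset.
- move=> _ _ /imsetP[c1 G1 ->] /imsetP[c2 G2 ->] neq; rewrite card_blockI agrG //.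
  by apply: contraNneq neq => ->.
move=> S le_S.
have -> : [set A in [set block c | c in G] | S \subset A] =
    [set block c | c in [set c in G | S \subset block c]].
  apply/setP => A; rewrite inE; apply/andP/imsetP => [[/imsetP[c Gc ->] sub]|[c]].
    by exists c; rewrite // inE Gc.
  by rewrite inE => /andP[Gc sub] ->; rewrite imset_f.
rewrite card_imset //.
have [->|[c0]] := set_0Vmem [set c in G | S \subset block c]; first by rewrite cards0.
rewrite inE => /andP[G0 sub0].
(* the positions at which the codewords are prescribed by S *)
pose P := [set i | phi (i, c0 i) \in S].
have cardP : #|P| = #|S|.
  rewrite -(@card_imset _ _ (fun i => phi (i, c0 i))); last by move=> i j /phi_inj[].
  congr #|pred_of_set _|; apply/setP => x; apply/imsetP/idP => [[i]|Sx].
    by rewrite inE => Si ->.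
  by have /imsetP[i _ xE] := subsetP sub0 _ Sx; exists i; rewrite // inE -xE.
have agrP c : S \subset block c -> forall i, i \in P -> c i = c0 i.
  by move=> sub i; rewrite inE => /(subsetP sub); rewrite blockE => /eqP.
have [D [PD cardD]] : exists D : {set 'I_k}, P \subset D /\ #|D| = d.
  have : d - #|P| <= #|~: P| by have := cardsC P; rewrite card_ord; lia.
  case/card_geqP => s [us sizes subs].
  have cards : #|[set x in s]| = d - #|P| by rewrite cardsE -sizes; apply/card_uniqP.
  exists (P :|: [set x in s]).
  rewrite subsetUl cardsU disjoint_setI0 ?cards0 ?subn0.
    by split=> //; rewrite cards subnKC // cardP.
  rewrite disjoint_sym disjoints_subset; apply/subsetP => x.
  by rewrite inE => /subs.
(* a word with prescribed values on P is determined by its values on E, since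
   P and E together have d elements *)
pose E := D :\: P.
have cardDP : #|E| = d - #|S| by rewrite cardsD (setIidPr PD) cardD cardP.
pose res (c : {ffun 'I_k -> T}) : {ffun 'I_k -> T} :=
  [ffun i => if i \in E then c i else t0].
rewrite -cardDP -(card_pffun_on t0 (mem E) (@predT T)).
rewrite -(@card_in_imset _ _ res).
  apply: subset_leq_card; apply/subsetP => _ /imsetP[c _ ->].
  apply/pffun_onP; split=> //; apply/subsetP => i.
  by rewrite inE ffunE; case: (i \in E) => //=; rewrite eqxx.
move=> c1 c2; rewrite !inE => /andP[G1 sub1] /andP[G2 sub2] /ffunP e.
apply/eqP; apply: contraLR (leqnn d) => /(agrG _ _ G1 G2); rewrite -ltnNge.
apply: leq_ltn_trans; rewrite -cardD; apply: subset_leq_card.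
apply/subsetP => i Di; rewrite inE; apply/eqP.
have [Pi|nPi] := boolP (i \in P); first by rewrite (agrP c1) ?(agrP c2).
by have := e i; rewrite !ffunE inE nPi Di.
Qed.

Lemma exists_partial_design k d n a b :
    1 < k -> d <= k -> k <= 2 ^ a -> k <= 3 ^ b -> k * (2 ^ a * 3 ^ b) <= n ->
  exists F : {set {set 'I_n}}, partial_design k d (2 ^ a * 3 ^ b) F.
Proof.
move=> k1 le_dk ka kb le_n.
have [T [G [cardT mds]]] := exists_mds_code k1 le_dk ka kb.
by rewrite -cardT in le_n *; apply: design_of_code mds _ le_dk le_n;
  rewrite cardT muln_gt0 !expn_gt0.
Qed.

Lemma ffact_le_exp m d : m ^_ d <= m ^ d.
Proof.
elim: d m => [|e IH] [|m] //; rewrite ?ffact0n // ffactSS expnS leq_mul2l.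
by rewrite (leq_trans (IH m)) ?orbT //; case: (e) => // e'; rewrite leq_exp2r.
Qed.

(** The d-sets contained in some block of F. *)
Definition covered n d (F : {set {set 'I_n}}) : {set {set 'I_n}} :=
  [set I : {set 'I_n} | (#|I| == d) && [exists A in F, I \subset A]].

Section Design.
Variables (n k d q : nat) (F : {set {set 'I_n}}).
Hypothesis des : partial_design k d q F.

(* The case #|S| = d of the bound on the number of blocks through S. *)
Lemma design_le1 (I : {set 'I_n}) : #|I| = d -> #|[set A in F | I \subset A]| <= 1.
Proof.
by case: des => _ _ _ deg cardI; have := deg I; rewrite cardI subnn leqnn; exact.
Qed.

(** Double counting of the pairs (I, A) with I a d-subset of the block A. *)
Lemma card_covered : #|covered d F| = q ^ d * 'C(k, d).
Proof.
have [cardA cardF _ _] := des.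
rewrite -cardF -sum_nat_const.
have -> : \sum_(A in F) 'C(k, d) =
    \sum_(A in F) #|[set I : {set 'I_n} | I \subset A & #|I| == d]|.
  by apply: eq_bigr => A FA; rewrite cards_draws cardA.
under eq_bigr do rewrite -sum1dep_card.
rewrite -sum1_card (exchange_big_dep predT) //= big_mkcond; apply: eq_bigr => I _.
rewrite sum1dep_card inE; have [cardI|neqI] := eqVneq #|I| d; last first.
  by apply/esym/eqP; rewrite cards_eq0; apply/eqP/setP => A; rewrite !inE !andbF.
have -> : [set A in F | (I \subset A) && true] = [set A in F | I \subset A].
  by apply/setP => A; rewrite !inE andbT.
apply/eqP; rewrite eq_sym; case: ifP => [/existsP[A IA]|/existsP noA].
  rewrite eqn_leq design_le1 //= card_gt0; apply/set0Pn; exists A; by rewrite inE.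
rewrite cards_eq0; apply: contraPT noA => /set0Pn[A]; rewrite inE => IA.
by case; exists A.
Qed.

Lemma design_half_covering :
    n ^ d <= 2 * (q * (k - d)) ^ d ->
  #|[set I : {set 'I_n} | #|I| == d]| <= 2 * #|covered d F|.
Proof.
move=> le_n; rewrite card_draws card_ord card_covered.
rewrite -(leq_pmul2r (fact_gt0 d)) -!mulnA !bin_ffact.
have ffact_ge m : (m - d) ^ d <= m ^_ d.
  elim: d m => [|e IH] [|m] //.
    by rewrite sub0n exp0n.
  rewrite ffactSS expnS subSS leq_mul // ?IH //.
  by rewrite (leq_trans (leq_subr _ _)).
apply: leq_trans (ffact_le_exp _ _) (leq_trans le_n _).
by rewrite expnMn !leq_mul2l ffact_ge !orbT.
Qed.

End Design.

Local Open Scope ring_scope.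

(** * Pivotal coordinates and Fourier coefficients *)

Section Fourier.
Variables (R : realType) (n : nat).
Implicit Types (f g : cube n -> R) (x y z : cube n) (I J K : {set 'I_n}).

Lemma card_cube : #|{: cube n}| = (2 ^ n)%N.
Proof. by rewrite card_ffun card_bool card_ord. Qed.

Lemma pow2n_gt0 : 0 < (2 ^ n)%:R :> R.
Proof. by rewrite ltr0n expn_gt0. Qed.

Lemma normr_chi J x : `|chi R J x| = 1.
Proof.
by rewrite /chi normr_prod big1 // => i _; rewrite /Defs.coord normrX normrN1 expr1n.
Qed.

Lemma parseval f : \sum_J fourier f J ^+ 2 = (\sum_x f x ^+ 2) / (2 ^ n)%:R.
Proof.
under [in RHS]eq_bigr do
  rewrite expr2 {2}(fourier_expansionP f) mulr_sumr.
rewrite exchange_big /= mulr_suml; apply: eq_bigr => J _.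
rewrite expr2 {2}fourierE mulrA mulr_sumr; congr (_ / _).
by apply: eq_bigr => x _; ring.
Qed.

(** The point with the coordinates of z in J and those of x outside J. *)
Definition mix J x z : cube n := [ffun j => if j \in J then z j else x j].

(** The part of f carried by the characters chi_K with K containing J
    (see [fourier_laplacian]), written as an average over the coordinates in J.
    The sum runs over all z, although only the coordinates of z in J matter. *)
Definition laplacian J f x : R :=
  (\sum_z f (mix J x z) * chi R J z) / (2 ^ n)%:R * chi R J x.

Lemma chi_mix J K x z :
  chi R K (mix J x z) = chi R (K :\: J) x * chi R (K :&: J) z.
Proof.
rewrite !chiE -big_split /=; apply: eq_bigr => i _.
rewrite !inE /Defs.coord ffunE; case: (i \in K); case: (i \in J) => /=;
  by rewrite ?(mulr1, mul1r).
Qed.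

Lemma chi_setD J K x : J \subset K -> chi R (K :\: J) x * chi R J x = chi R K x.
Proof.
move=> /subsetP sub; rewrite !chiE -big_split /=; apply: eq_bigr => i _.
have := sub i; rewrite inE; case: (i \in K); case: (i \in J) => /= H;
  by rewrite ?(mulr1, mul1r) //; have := H isT.
Qed.

Lemma fourier_laplacian J f K :
  fourier (laplacian J f) K = if J \subset K then fourier f K else 0.
Proof.
have -> : fourier (laplacian J f) =
    [ffun K : {set _} => if J \subset K then fourier f K else 0].
  apply: fourier_expansion_unique (fourier_expansionP _) _ => x.
  rewrite /laplacian.
  under eq_bigr do rewrite fourier_expansionP mulr_suml.
  rewrite exchange_big /= mulr_suml mulr_suml; apply: eq_bigr => L _.
  under eq_bigr => z _.
    rewrite chi_mix.
    rewrite (_ : _ * _ =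
      fourier f L * chi R (L :\: J) x * (chi R (L :&: J) z * chi R J z)).
      over.
    by ring.
  rewrite -mulr_sumr sum_chi_points ffunE.
  rewrite (sameP setIidPr eqP) mulrA mulfK ?gt_eqF ?pow2n_gt0 //.
  have [e|] := eqVneq (L :&: J) J; last by rewrite mulr0 !mul0r.
  by rewrite mulr1 -mulrA chi_setD // -e subsetIl.
by rewrite ffunE.
Qed.

Lemma laplacian_le1 J f x : (forall y, `|f y| = 1) -> `|laplacian J f x| <= 1.
Proof.
move=> f1; rewrite /laplacian normrM normr_chi mulr1 normrM.
rewrite normfV (gtr0_norm pow2n_gt0) ler_pdivrMr ?pow2n_gt0 // mul1r.
apply: le_trans (ler_norm_sum _ _ _) _.
under eq_bigr do rewrite normrM f1 normr_chi mul1r.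
by rewrite sumr_const card_cube.
Qed.

Lemma flipK i : involutive (@flip n ^~ i).
Proof.
by move=> x; apply/ffunP => j; rewrite !ffunE; case: eqP; rewrite ?negbK.
Qed.

Lemma chi_flip J x i : i \in J -> chi R J (flip x i) = - chi R J x.
Proof.
move=> Ji; rewrite /chi (bigD1 i) //= [in RHS](bigD1 i) //= coord_flip eqxx.
rewrite mulNr; congr (- (_ * _)); apply: eq_bigr => j /andP[_ /negbTE neq].
by rewrite coord_flip neq.
Qed.

(** If i is not pivotal, the terms of z and of z with its i-th coordinate
    negated cancel. *)
Lemma laplacian_eq0 J f x i : i \in J -> ~~ pivotal J f x i -> laplacian J f x = 0.
Proof.
move=> Ji; rewrite negb_exists => /forallP npiv.
rewrite /laplacian; set S := \sum_z _.
suff -> : S = 0 by rewrite !mul0r.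
have : S = - S.
  rewrite {1}/S (reindex_inj (inv_inj (flipK i))) -sumrN; apply: eq_bigr => z _.
  rewrite chi_flip // mulrN; congr (- (_ * _)).
  have -> : mix J x (flip z i) = flip (mix J x z) i.
    apply/ffunP => j; rewrite !ffunE; have [->|_] := eqVneq j i; first by rewrite Ji.
    by [].
  have := npiv (mix J x z); rewrite negb_and negbK => /orP[|/eqP //].
  case/negP; apply/'forall_implyP => j; rewrite inE => /negbTE nJ.
  by rewrite ffunE nJ.
by move=> e; lra.
Qed.

Lemma laplacian_le_pivotal J f x : (forall y, `|f y| = 1) ->
  `|laplacian J f x| <= (x \in [set y | [forall i in J, pivotal J f y i]])%:R.
Proof.
move=> f1; rewrite inE; case: (boolP [forall i in J, _]) => [_|].
  exact: laplacian_le1.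
rewrite negb_forall => /existsP[i]; rewrite negb_imply => /andP[Ji np].
by rewrite (laplacian_eq0 Ji np) normr0.
Qed.

Lemma muE (E : {set cube n}) :
  mu E = (\sum_x (x \in E)%:R) / (2 ^ n)%:R :> R.
Proof.
rewrite /mu card_cube -sum1_card natr_sum big_mkcond; congr (_ / _).
by apply: eq_bigr => x _; case: (x \in E).
Qed.

(** By Parseval, Inf_J(f) is the mean square of the laplacian. *)
Lemma Inf_le_JInf J f : (forall y, `|f y| = 1) -> Inf J f <= JInf J f.
Proof.
move=> f1; rewrite /JInf muE /Inf big_mkcond /=.
under eq_bigr => K _.
  rewrite (_ : (if _ then _ else _) = fourier (laplacian J f) K ^+ 2).
    over.
  by rewrite fourier_laplacian; case: ifP => //; rewrite expr0n.
rewrite parseval ler_pM2r ?invr_gt0 ?pow2n_gt0 //.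
apply: ler_sum => x _; have := laplacian_le_pivotal J x f1.
rewrite -real_normK ?num_real //; case: (x \in _) => /= h; first by rewrite exprn_ile1.
by move: h; rewrite normr_le0 => /eqP ->; rewrite normr0 expr0n.
Qed.

(** f and its laplacian have the same coefficient at J. *)
Lemma fourier_le_JInf J f : (forall y, `|f y| = 1) -> `|fourier f J| <= JInf J f.
Proof.
move=> f1; have := fourier_laplacian J f J; rewrite subxx => <-.
rewrite fourierE /JInf muE normrM normfV (gtr0_norm pow2n_gt0).
rewrite ler_pM2r ?invr_gt0 ?pow2n_gt0 //.
apply: le_trans (ler_norm_sum _ _ _) _; apply: ler_sum => x _.
by rewrite normrM normr_chi mulr1 laplacian_le_pivotal.
Qed.

End Fourier.

(** * Joint influences of a hypertribe function *)

Section Probability.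
Variables (R : realType) (n : nat).
Implicit Types (E : {set cube n}) (S A : {set 'I_n}) (x : cube n).

(** The event that all the coordinates in S are +1, that is, [false]. *)
Definition sat S : {set cube n} := [set x : cube n | [forall i in S, ~~ x i]].

Lemma mu_sat S : mu (sat S) = 2^-1 ^+ #|S| :> R.
Proof.
have -> : mu (sat S) = (2 ^ #|~: S|)%:R / (2 ^ n)%:R :> R.
  rewrite /mu card_cube; congr (_%:R / _).
  rewrite -[in RHS]card_bool -(card_pffun_on false (mem (~: S)) (@predT bool)).
  apply: eq_card => x; rewrite inE; apply/'forall_implyP/pffun_onP => [Sx|[Sx _] i Si].
    split=> //; apply/subsetP => i; rewrite !inE; apply: contraL => /Sx.
    by case: (x i).
  have := subsetP Sx i; rewrite !inE Si.
  by case: (x i) => // /(_ isT).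
have -> : (2 ^ n = 2 ^ #|S| * 2 ^ #|~: S|)%N.
  by rewrite -expnD cardsC card_ord.
by rewrite natrM invfM mulrCA mulfV ?mulr1 ?natrX ?exprVn // expf_neq0 // pnatr_eq0.
Qed.

Lemma mu_ge0 E : 0 <= mu E :> R.
Proof. by rewrite /mu divr_ge0. Qed.

Lemma mu_le E E' : E \subset E' -> mu E <= mu E' :> R.
Proof.
move=> sub; rewrite /mu ler_pM2r ?ler_nat ?subset_leq_card //.
by rewrite card_cube invr_gt0 pow2n_gt0.
Qed.

(** The union bound. *)
Lemma mu_cover (I : finType) (P : pred I) (G : I -> {set cube n}) E :
    (forall x, x \in E -> exists2 i, P i & x \in G i) ->
  mu E <= \sum_(i | P i) mu (G i) :> R.
Proof.
move=> cov; under [leRHS]eq_bigr do rewrite muE.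
rewrite muE -mulr_suml ler_pM2r ?invr_gt0 ?pow2n_gt0 // exchange_big /=.
apply: ler_sum => x _; case: (boolP (x \in E)) => [/cov[i Pi Gi]|_].
  by rewrite (bigD1 i) //= Gi lerDl sumr_ge0.
exact: sumr_ge0.
Qed.

End Probability.

Section Hypertribe.
Variables (R : realType) (n k d q : nat) (F : {set {set 'I_n}}) (L : R).
Hypotheses (des : partial_design k d q F) (L0 : 0 < L)
  (Ld : L ^+ d = 2^-1 ^+ k) (qL1 : q%:R * L <= 1).
Implicit Types (A B S U K J : {set 'I_n}) (x y : cube n).

(* In the application L = log2 n / n, and Ld says that a tribe of size k is
   satisfied with probability L ^ d. *)
Let H := hypertribe R F.

Lemma coord_eq1 x i : (Defs.coord x i == 1 :> R) = ~~ x i.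
Proof.
rewrite /Defs.coord; case: (x i); rewrite ?expr0 ?eqxx // expr1.
by apply/eqP => e; lra.
Qed.

(** The event that some tribe is satisfied. *)
Definition sat_family : {set cube n} := [set x | [exists A in F, x \in sat A]].

Lemma hypertribeE x : H x = if x \in sat_family then 1 else -1.
Proof.
rewrite /H /hypertribe inE; congr (if _ then _ else _).
apply: eq_existsb => A; rewrite inE; congr (_ && _).
by apply: eq_forallb => i; rewrite coord_eq1.
Qed.

Lemma normr_hypertribe x : `|H x| = 1.
Proof. by rewrite hypertribeE; case: ifP; rewrite ?normrN normr1. Qed.

(** The event that all the coordinates in U outside J are +1, and every i in K
    lies in a tribe whose coordinates outside J are all +1.  Here U stands for
    the union of the tribes already explored, and K for the set of those elements
    of J that these tribes do not contain. *)
Definition off_event J U K : {set cube n} :=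
  [set x | (x \in sat (U :\: J)) &&
     [forall i in K, exists A in F, (i \in A) && (x \in sat (A :\: J))]].

(** One of y and y with its i-th coordinate negated satisfies a tribe, the other
    none; this tribe contains i. *)
Lemma pivotal_tribe J x i : i \in J -> pivotal J H x i ->
  exists A, [/\ A \in F, i \in A & x \in sat (A :\: J)].
Proof.
move=> Ji /existsP[y /andP[/'forall_implyP agr neq]].
have flip_sat A : i \notin A -> (flip y i \in sat A) = (y \in sat A).
  move=> nA; rewrite !inE; apply: eq_forallb_in => j Aj; rewrite ffunE.
  by case: eqP Aj nA => // -> ->.
have off_sat A y' : (y' = y \/ y' = flip y i) -> y' \in sat A -> x \in sat (A :\: J).
  move=> y'E; rewrite !inE => /'forall_implyP sy.
  apply/'forall_implyP => j; rewrite inE => /andP[nJ /sy].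
  rewrite -(eqP (agr j _)) ?inE //.
  by case: y'E => ->; rewrite // ffunE; case: eqP nJ => // ->; rewrite Ji.
have tribe y' y'' : y' = y /\ y'' = flip y i \/ y' = flip y i /\ y'' = y ->
    y' \in sat_family -> y'' \notin sat_family ->
  exists A, [/\ A \in F, i \in A & x \in sat (A :\: J)].
  move=> yy; rewrite inE => /existsP[A /andP[FA sA]] nsat; exists A.
  split=> //; last by apply: off_sat sA; case: yy => -[]; [left|right].
  apply: contraR nsat => nA; rewrite inE; apply/existsP; exists A; rewrite FA.
  by case: yy sA => -[-> ->]; rewrite flip_sat.
move: neq; rewrite !hypertribeE.
case: (boolP (y \in sat_family)); case: (boolP (flip y i \in sat_family)) => s1 s2.
- by rewrite eqxx.
- by move=> _; apply: (tribe y (flip y i)) => //; left.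
- by move=> _; apply: (tribe (flip y i) y) => //; right.
by rewrite eqxx.
Qed.

Lemma JInf_le_off_event J : JInf J H <= mu (off_event J set0 J).
Proof.
apply/mu_le/subsetP => x; rewrite inE => /'forall_implyP piv.
rewrite inE; apply/andP; split.
  by rewrite inE; apply/'forall_implyP => j; rewrite !inE andbF.
apply/'forall_implyP => i Ji; have [A [FA Ai sA]] := pivotal_tribe Ji (piv i Ji).
by apply/existsP; exists A; rewrite FA Ai.
Qed.

(** Tribes are grouped by their trace S on K: there are at most q ^ (d - #|S|) of
    them for each S, and (q L) ^ (d - #|S|) <= 1. *)
Lemma sum_tribes_le K : (#|K| <= d)%N ->
  \sum_(A in F) 2^-1 ^+ k * L ^+ (#|K| - #|A :&: K|) <= 2 ^+ d * L ^+ #|K|.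
Proof.
move=> le_K.
rewrite (partition_big (fun A => A :&: K) (fun S => S \in powerset K)) /=; last first.
  by move=> A _; rewrite inE subsetIr.
apply: (@le_trans _ _ (\sum_(S in powerset K) L ^+ #|K|)); last first.
  rewrite sumr_const card_powerset -[X in X <= _]mulr_natl natrX.
  by rewrite ler_wpM2r ?exprn_ge0 ?(ltW L0) // ler_weXn2l // ler1n.
apply: ler_sum => S; rewrite inE => SK.
have le_S := subset_leq_card SK; have le_Sd := leq_trans le_S le_K.
have [_ _ _ /(_ S le_Sd) degS] := des.
under eq_bigr => A /andP[_ /eqP e] do rewrite e.
rewrite sumr_const -[X in X <= _]mulr_natl.
apply: (@le_trans _ _ ((q ^ (d - #|S|))%:R * (2^-1 ^+ k * L ^+ (#|K| - #|S|)))).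
  rewrite ler_wpM2r ?mulr_ge0 ?exprn_ge0 ?(ltW L0) ?invr_ge0 // ler_nat.
  apply: leq_trans degS; apply: subset_leq_card; apply/subsetP => A.
  by rewrite !inE => /andP[-> /eqP <-]; rewrite subsetIl.
rewrite -Ld -(subnK le_Sd) -{2}(subnK le_S) addnK natrX !exprD.
have -> : forall a b c e : R, a * (b * c * e) = a * b * (e * c) by move=> *; ring.
rewrite -exprMn ler_piMl ?mulr_ge0 ?exprn_ge0 ?(ltW L0) // exprn_ile1 //.
by rewrite mulr_ge0 // ltW.
Qed.

(** The factor lost in each step of the exploration: 2 ^ d for the choice of the
    trace of the new tribe on K, and 2 ^ (d + d * d) for those of its points that
    lie in J or in the tribes explored before. *)
Definition loss : R := 2 ^+ (d + (d + d * d)).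

(** Induction on #|K|: fix i in K and sum over the tribe A that contains i; then
    U and K are replaced by their union with A and difference with A.  The number
    m counts the tribes in U; a tribe meeting K differs from each of them, hence
    meets U in at most m * d points. *)
Lemma off_event_le J U K m : (#|J| <= d)%N -> (m + #|K| <= d)%N ->
    (forall A, A \in F -> A :&: K != set0 -> #|A :&: U| <= m * d)%N ->
  mu (off_event J U K) <= loss ^+ #|K| * 2^-1 ^+ #|U :\: J| * L ^+ #|K|.
Proof.
move=> le_J; have [c leKc] := ubnP #|K|; elim: c => // c IH in U K m leKc *.
move=> le_mK meetU.
have [->|[i Ki]] := set_0Vmem K.
  rewrite cards0 !expr0 mul1r mulr1 -mu_sat.
  by apply/mu_le/subsetP => x; rewrite inE => /andP[].
have loss1 : 1 <= loss by rewrite exprn_ege1 // ler1n.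
apply: (@le_trans _ _ (\sum_(A | (A \in F) && (i \in A))
    mu (off_event J (U :|: A) (K :\: A)))).
  apply: mu_cover => x; rewrite inE => /andP[sU /'forall_implyP cov].
  have /existsP[A /and3P[FA Ai sA]] := cov i Ki; exists A; first by rewrite FA.
  rewrite inE; apply/andP; split.
    move: sU sA; rewrite !inE => /'forall_implyP sU /'forall_implyP sA.
    apply/'forall_implyP => j; rewrite !inE => /andP[nJ /orP[Uj|Aj]].
      by apply: sU; rewrite inE nJ.
    by apply: sA; rewrite inE nJ.
  by apply/'forall_implyP => j; rewrite inE => /andP[_ /cov].
pose C : R := loss ^+ #|K|.-1 * 2^-1 ^+ #|U :\: J| * 2 ^+ (d + d * d).
have K0 : (0 < #|K|)%N by apply/card_gt0P; exists i.
apply: (@le_trans _ _ (\sum_(A in F)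
    C * (2^-1 ^+ k * L ^+ (#|K| - #|A :&: K|)))); last first.
  rewrite -mulr_sumr.
  have C0 : 0 <= C by rewrite !mulr_ge0 ?exprn_ge0 ?invr_ge0 // (le_trans _ loss1).
  apply: le_trans (ler_wpM2l C0 (sum_tribes_le _)) _; first by lia.
  rewrite /C -[in X in _ <= X](prednK K0) exprS {2}/loss (exprD 2 d (d + d * d)%N).
  by rewrite le_eqVlt; apply/orP; left; apply/eqP; rewrite prednK //; ring.
rewrite big_mkcondr /=; apply: ler_sum => A FA; case: ifP => [Ai|_]; last first.
  by rewrite !mulr_ge0 ?exprn_ge0 ?invr_ge0 ?(le_trans _ loss1) ?(ltW L0).
have AK0 : (0 < #|A :&: K|)%N by apply/card_gt0P; exists i; rewrite inE Ai.
have cardKA : #|K :\: A| = (#|K| - #|A :&: K|)%N by rewrite cardsD setIC.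
apply: le_trans (IH _ _ m.+1 _ _ _) _.
- by rewrite cardKA; lia.
- by rewrite cardKA; lia.
- move=> B FB BK; rewrite setIUr (leq_trans (leq_card_setU _ _)) //.
  have neqBA : B != A.
    apply: contraNneq BK => ->; apply/eqP/setP => j.
    by rewrite !inE; case: (j \in A).
  have [_ _ meet _] := des; have := meet B A FB FA neqBA.
  have : (#|B :&: U| <= m * d)%N.
    apply: meetU => //; apply: contraNneq BK => BK; apply/eqP/setP => j.
    by have /setP/(_ j) := BK; rewrite !inE => e; rewrite andbCA e andbF.
  by move=> h1 h2; rewrite mulSnr leq_add // ltnW.
rewrite cardKA mulrA ler_wpM2r ?exprn_ge0 ?(ltW L0) // /C -!mulrA.
apply: ler_pM; rewrite ?exprn_ge0 ?invr_ge0 ?(le_trans _ loss1) //.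
  by rewrite ler_weXn2l //; lia.
(* A has at least k - d - d * d points outside J and U *)
have le_card : (#|U :\: J| + k <= #|(U :|: A) :\: J| + (d + d * d))%N.
  have [/(_ A FA) cardA _ _ _] := des.
  have AU : (#|A :&: U| <= d * d)%N.
    apply: leq_trans (meetU A FA _) _; first by rewrite -card_gt0.
    by rewrite leq_mul2r; lia.
  have : (#|A| <= #|A :&: J| + #|A :&: U| + #|A :\: (U :|: J)|)%N.
    rewrite -(cardsID (U :|: J) A) leq_add2r setIUr addnC.
    exact: leq_card_setU.
  have -> : (U :|: A) :\: J = (U :\: J) :|: (A :\: (U :|: J)).
    by apply/setP => j; rewrite !inE; case: (j \in U); case: (j \in J); rewrite ?orbT.
  have dis : (U :\: J) :&: (A :\: (U :|: J)) = set0.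
    by apply/setP => j; rewrite !inE; case: (j \in U); rewrite ?andbF.
  rewrite cardsU dis cards0 subn0.
  have := subset_leq_card (subsetIr A J); lia.
have : 2^-1 ^+ (#|(U :|: A) :\: J| + (d + d * d)) <= 2^-1 ^+ (#|U :\: J| + k) :> R.
  by rewrite ler_wiXn2l // ?invr_ge0 // invf_le1 // ler1n.
rewrite [X in X <= _](exprD _ _ (d + d * d)%N) (exprVn 2 (d + d * d)).
rewrite ler_pdivrMr ?exprn_gt0 // (exprD _ _ k) => /le_trans; apply.
by rewrite le_eqVlt; apply/orP; left; apply/eqP; ring.
Qed.

Lemma JInf_hypertribe_le J : (#|J| <= d)%N -> JInf J H <= loss ^+ d * L ^+ #|J|.
Proof.
move=> le_J; apply: le_trans (JInf_le_off_event J) _.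
apply: le_trans (off_event_le (m := 0) le_J _ _) _ => //.
  by move=> A _ _; rewrite setI0 cards0.
rewrite set0D cards0 expr0 mulr1 ler_wpM2r ?exprn_ge0 ?(ltW L0) //.
by rewrite ler_weXn2l // exprn_ege1 // ler1n.
Qed.

End Hypertribe.

(** * Fourier weight of a hypertribe function above level d *)

Section Weight.
Variables (R : realType) (n k d q : nat) (F : {set {set 'I_n}}) (L : R).
Hypotheses (des : partial_design k d q F) (L0 : 0 < L)
  (Ld : L ^+ d = 2^-1 ^+ k) (d2 : (2 <= d)%N) (qL2 : (2 * (q%:R * L)) ^+ d <= 2).
Implicit Types (A B J : {set 'I_n}) (x : cube n).
Let H := hypertribe R F.

(* The expected number of satisfied tribes, see sum_mu_tribes. *)
Let lambda : R := (q%:R * L) ^+ d.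

Lemma lambdaE : lambda = #|F|%:R * 2^-1 ^+ k.
Proof. by rewrite /lambda exprMn Ld; have [_ -> _ _] := des; rewrite natrX. Qed.

Lemma lambda_ge0 : 0 <= lambda.
Proof. by rewrite exprn_ge0 // mulr_ge0 // ltW. Qed.

Lemma lambda_le : lambda * 2 ^+ d <= 2.
Proof. by rewrite mulrC -exprMn. Qed.

Lemma lambda_le_half : lambda <= 2^-1.
Proof.
have := lambda_le; rewrite -(subnK d2) exprD.
have : 1 <= 2 ^+ (d - 2) :> R by rewrite exprn_ege1 // ler1n.
have := lambda_ge0; set l := lambda; set a := 2 ^+ (d - 2).
move=> l0 a1; have : l <= l * a by rewrite ler_peMr.
by rewrite mulrA expr2 => h1 h2; lra.
Qed.

Lemma sum_mu_tribes : \sum_(A in F) mu (sat A) = lambda.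
Proof.
rewrite lambdaE mulr_natl -sumr_const; apply: eq_bigr => A FA.
by rewrite mu_sat; have [-> //] := des.
Qed.

(** The second moment of the number of satisfied tribes.  Distinct tribes share at
    most d - 1 points, so the off-diagonal terms sum to at most
    lambda ^ 2 * 2 ^ (d - 1) <= lambda. *)
Lemma sum_mu_tribe_pairs :
  \sum_(A in F) \sum_(B in F) mu (sat (A :|: B)) <= lambda + lambda.
Proof.
have [cardA cardF meet _] := des.
apply: (@le_trans _ _ (\sum_(A in F)
    (2^-1 ^+ k + \sum_(B in F) 2^-1 ^+ k * 2^-1 ^+ k * 2 ^+ d.-1))).
  apply: ler_sum => A FA; rewrite (bigD1 A FA) /= setUid mu_sat cardA // lerD2l.
  rewrite [leRHS](bigD1 A FA) /= ler_wpDl ?mulr_ge0 ?exprn_ge0 ?invr_ge0 //.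
  apply: ler_sum => B /andP[FB neq]; rewrite mu_sat cardsU (cardA A) ?(cardA B) //.
  rewrite -exprD -ler_pdivrMr ?exprn_gt0 // -exprVn -exprD.
  rewrite ler_wiXn2l ?invr_ge0 ?invf_le1 ?ler1n //.
  have : A != B by rewrite eq_sym.
  by move=> /(meet A B FA FB); lia.
have sum_cst (c : R) : \sum_(A in F) c = #|F|%:R * c by rewrite sumr_const mulr_natl.
rewrite big_split /= !sum_cst -lambdaE lerD2l.
have E (f h w : R) : f * (f * (h * h * w)) = f * h * (f * h * w) by ring.
rewrite E -lambdaE ler_piMr ?lambda_ge0 //.
have := lambda_le; rewrite -{1}(prednK (ltnW d2)) exprS.
by move: lambda (2 ^+ _) => l a h; lra.
Qed.

Lemma mu_sat_family_le : mu (sat_family F) <= lambda.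
Proof.
rewrite -sum_mu_tribes; apply: mu_cover => x; rewrite inE => /existsP[A /andP[FA sA]].
by exists A.
Qed.

(** The Bonferroni inequality, in the form 3 N <= 2 [N > 0] + N ^ 2 for the number
    N of tribes satisfied at x. *)
Lemma mu_sat_family_ge : lambda / 2 <= mu (sat_family F) :> R.
Proof.
have bonf x : 3 * (\sum_(A in F) (x \in sat A)%:R) <=
   2 * (x \in sat_family F)%:R +
     \sum_(A in F) \sum_(B in F) (x \in sat (A :|: B))%:R :> R.
  pose N := #|[set A in F | x \in sat A]|.
  have -> : \sum_(A in F) (x \in sat A)%:R = N%:R :> R.
    rewrite /N -sum1dep_card natr_sum big_mkcondr; apply: eq_bigr => A _.
    by case: (x \in sat A).
  have -> : \sum_(A in F) \sum_(B in F) (x \in sat (A :|: B))%:R = (N * N)%:R :> R.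
    have satU A B : (x \in sat (A :|: B)) = (x \in sat A) && (x \in sat B).
      rewrite !inE; apply/idP/andP.
        by move=> /'forall_implyP s; split; apply/'forall_implyP => j Aj; apply: s;
          rewrite inE Aj ?orbT.
      case=> /'forall_implyP sA /'forall_implyP sB.
      by apply/'forall_implyP => j; rewrite inE => /orP[/sA|/sB].
    rewrite natrM /N -sum1dep_card natr_sum big_mkcondr mulr_suml.
    apply: eq_bigr => A _; case sA: (x \in sat A); last first.
      by rewrite mul0r big1 // => B _; rewrite satU sA.
    rewrite mul1r; apply: eq_bigr => B _; rewrite satU sA.
    by case: (x \in sat B).
  have -> : (x \in sat_family F) = (0 < N)%N.
    rewrite inE; apply/existsP/card_gt0P => -[A].
      by move=> h; exists A; rewrite inE.
    by rewrite inE => h; exists A.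
  rewrite -!natrM -natrD ler_nat; move: N => [|[|N]] /=; nia.
have {bonf}bonf : 3 * lambda <= 2 * mu (sat_family F) + (lambda + lambda).
  apply: le_trans (lerD (lexx _) sum_mu_tribe_pairs).
  rewrite -sum_mu_tribes.
  under eq_bigr do rewrite muE.
  under [X in _ <= _ + X]eq_bigr => A _ do under eq_bigr => B _ do rewrite muE.
  under [X in _ <= _ + X]eq_bigr => A _ do rewrite -mulr_suml.
  rewrite -!mulr_suml muE mulrA [2 * _]mulrA -mulrDl.
  rewrite ler_pM2r ?invr_gt0 ?pow2n_gt0 //.
  under [X in _ <= _ + X]eq_bigr => A _ do rewrite exchange_big /=.
  rewrite exchange_big /= [X in _ <= _ + X]exchange_big /= !mulr_sumr -big_split /=.
  exact: ler_sum.
lra.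
Qed.

Lemma fourier_hypertribe0 : fourier H set0 = 2 * mu (sat_family F) - 1.
Proof.
have N0 : (2 ^ n)%:R != 0 :> R by rewrite gt_eqF ?pow2n_gt0.
rewrite fourierE muE; apply: (canLR (mulfK N0)).
rewrite mulrBl mul1r mulrA mulfVK // mulr_sumr.
have -> : (2 ^ n)%:R = \sum_(x : cube n) 1 :> R by rewrite sumr_const card_cube.
rewrite -sumrB; apply: eq_bigr => x _.
rewrite /chi big_set0 mulr1 /H hypertribeE; case: ifP => _ /=; lra.
Qed.

(** The weights of all levels sum to 1; that of level 0 is the square of
    2 p - 1 with lambda / 2 <= p <= 1 / 2, hence at most 1 - lambda; that of a
    level s between 1 and d - 1 is at most 'C(n, s) (C L ^ s) ^ 2, hence at most
    C ^ 2 n L ^ 2. *)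
Lemma weight_hypertribe_ge (C : R) : 0 <= C -> n%:R * L ^+ 2 <= 1 ->
    (forall J, (#|J| < d)%N -> JInf J H <= C * L ^+ #|J|) ->
  lambda - C ^+ 2 * d%:R * (n%:R * L ^+ 2) <= weight_ge d H.
Proof.
move=> C0 nL leC.
have total : \sum_J fourier H J ^+ 2 = 1.
  rewrite parseval (eq_bigr (fun _ => 1)) => [|x _].
    by rewrite sumr_const card_cube divff // gt_eqF ?pow2n_gt0.
  by rewrite -real_normK ?num_real // normr_hypertribe expr1n.
have low : \sum_(J | (J != set0) && (#|J| < d)%N) fourier H J ^+ 2 <=
    C ^+ 2 * d%:R * (n%:R * L ^+ 2).
  apply: (@le_trans _ _ (\sum_(J | (J != set0) && (#|J| < d)%N)
      C ^+ 2 * (L ^+ 2) ^+ #|J|)).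
    apply: ler_sum => J /andP[_ Jd].
    rewrite -real_normK ?num_real // exprAC -exprMn lerXn2r ?nnegrE ?normr_ge0 //.
      by rewrite mulr_ge0 // exprn_ge0 // ltW.
    by apply: le_trans (leC J Jd); apply: fourier_le_JInf => x; apply: normr_hypertribe.
  rewrite -mulr_sumr -mulrA ler_wpM2l ?exprn_ge0 //.
  rewrite (partition_big (fun J : {set 'I_n} => inord #|J| : 'I_d.-1.+1) predT) //=.
  have dS : d.-1.+1 = d by rewrite prednK // ltnW.
  apply: (@le_trans _ _ (\sum_(s : 'I_d.-1.+1) n%:R * L ^+ 2)); last first.
    by rewrite sumr_const card_ord dS -[leLHS]mulr_natl.
  apply: ler_sum => s _.
  have sE J : (#|J| < d)%N -> inord #|J| = s -> #|J| = s :> nat.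
    by move=> Jd <-; rewrite inordK // dS.
  have L2 : 0 <= L ^+ 2 by rewrite exprn_ge0 // ltW.
  have nL0 : 0 <= n%:R * L ^+ 2 by apply: mulr_ge0.
  have [s0|s0] := posnP s.
    rewrite big1 // => J /andP[/andP[J0 Jd] /eqP e].
    have /eqP := sE _ Jd e; rewrite s0.
    by rewrite cards_eq0 (negbTE J0).
  apply: (@le_trans _ _ (\sum_(J : {set 'I_n} | #|J| == s) (L ^+ 2) ^+ s)).
    rewrite big_mkcond [leRHS]big_mkcond; apply: ler_sum => J _.
    case: ifP => [/andP[/andP[_ Jd] /eqP e]|_].
      by rewrite (sE _ Jd e) eqxx.
    by case: ifP => // _; rewrite exprn_ge0.
  rewrite sumr_const.
  have -> : #|[pred J : {set 'I_n} | #|J| == s]| = 'C(n, s).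
    by rewrite -[in RHS](card_ord n) -card_draws cardsE.
  rewrite -[leLHS]mulr_natl; apply: (@le_trans _ _ ((n%:R * L ^+ 2) ^+ s)).
    rewrite [leRHS]exprMn ler_wpM2r ?exprn_ge0 ?(ltW L0) // -natrX ler_nat.
    apply: (@leq_trans (n ^_ s)); first by rewrite -bin_ffact leq_pmulr ?fact_gt0.
    exact: ffact_le_exp.
  by rewrite -[leRHS]expr1 ler_wiXn2l.
rewrite /weight_ge.
have split3 : \sum_J fourier H J ^+ 2 = fourier H set0 ^+ 2 +
    \sum_(J | (J != set0) && (#|J| < d)%N) fourier H J ^+ 2 +
    \sum_(J : {set 'I_n} | (d <= #|J|)%N) fourier H J ^+ 2.
  rewrite (bigD1 set0) //= -addrA; congr (_ + _).
  rewrite (bigID (fun J : {set 'I_n} => (#|J| < d)%N)) /=; congr (_ + _).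
  apply: eq_bigl => J; rewrite -leqNgt; case: eqVneq => //= ->.
  by rewrite cards0; case: (d) d2.
move: split3; rewrite total fourier_hypertribe0.
have := mu_sat_family_ge; have := mu_sat_family_le; have := lambda_le_half.
have := mu_ge0 R (sat_family F); set p := mu _ => p0 l1 l2 l3 total'.
have : lambda <= 1 - (2 * p - 1) ^+ 2 by nra.
move: low total'; set w1 := \sum_(J | _) _; set w2 := \sum_(J | _) _.
by move=> h1 h2 h3; lra.
Qed.

End Weight.

(** * Asymptotics of the tribe size *)

Section Asymptotics.
Variable R : realType.
Implicit Types (n k d : nat).

Lemma ln2_gt0 : 0 < ln 2 :> R.
Proof. by rewrite ln_gt0 // ltr1n. Qed.

Lemma log2_growth (M : R) (m : nat) : exists n0, forall n, (n0 <= n)%N ->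
  M <= log2 n%:R /\ M * log2 n%:R ^+ m <= n%:R.
Proof.
have c0 := ln2_gt0; set c : R := ln 2 in c0 *.
pose B : R := `|M| * c + `|M| / c ^+ m * (m.+1)`!%:R.
have B1 : 0 <= `|M| * c by rewrite mulr_ge0 // ltW.
have B2 : 0 <= `|M| / c ^+ m * (m.+1)`!%:R.
  by rewrite !mulr_ge0 // invr_ge0 exprn_ge0 // ltW.
have B0 : 0 <= B by rewrite addr_ge0.
exists (Num.bound (expR B)) => n le_n.
have nB : expR B <= n%:R.
  apply: le_trans (ltW (archi_boundP (expR_ge0 B))) _.
  by rewrite ler_nat.
have n0 : 0 < n%:R :> R := lt_le_trans (expR_gt0 B) nB.
pose x : R := ln n%:R.
have xB : B <= x by rewrite -[B]expRK ler_ln ?posrE ?expR_gt0.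
have x0 : 0 <= x := le_trans B0 xB.
have xE : expR x = n%:R by rewrite lnK // posrE.
rewrite /log2 -/x -/c; split.
  rewrite ler_pdivlMr //; apply: le_trans xB; rewrite /B.
  have : M * c <= `|M| * c by rewrite ler_wpM2r ?ler_norm // ltW.
  by move=> h; lra.
apply: (@le_trans _ _ (x ^+ m.+1 / (m.+1)`!%:R)); last first.
  rewrite -xE; apply: le_trans (expR_ge1Dxn m x0); lra.
rewrite expr_div_n exprS ler_pdivlMr ?ltr0n ?fact_gt0 //.
have -> : M * (x ^+ m / c ^+ m) * (m.+1)`!%:R =
  M / c ^+ m * (m.+1)`!%:R * x ^+ m by ring.
rewrite ler_wpM2r ?exprn_ge0 //; apply: le_trans xB.
rewrite /B; apply: (@le_trans _ _ (`|M| / c ^+ m * (m.+1)`!%:R)); last lra.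
by rewrite -!mulrA ler_wpM2r ?ler_norm // mulr_ge0 // invr_ge0 exprn_ge0 // ltW.
Qed.

Lemma tribe_size_pow d n k : 0 < n%:R :> R -> 0 < log2 n%:R :> R ->
  k%:R = tribe_size R d n -> (log2 (n%:R : R) / n%:R) ^+ d = 2^-1 ^+ k.
Proof.
move=> n0 l0 sizeE.
have e : k%:R * ln 2 = d%:R * ln (n%:R / log2 n%:R) :> R.
  by rewrite sizeE /tribe_size {1}/log2 mulrA mulfVK // gt_eqF // ln2_gt0.
apply: invr_inj; rewrite -!exprVn invf_div invrK.
have x0 : 0 < n%:R / log2 n%:R :> R := divr_gt0 n0 l0.
apply: ln_inj; rewrite ?posrE ?exprn_gt0 //.
by rewrite lnXn // lnXn // -[LHS]mulr_natl -e mulr_natl.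
Qed.

(** The tribe size is d (log2 n - log2 (log2 n)), and the hypothesis says that
    2 d log2 (log2 n) <= log2 n. *)
Lemma tribe_size_bounds d n : (0 < d)%N -> 1 <= log2 n%:R :> R ->
    log2 n%:R ^+ (2 * d) <= n%:R :> R ->
  (d%:R - 2^-1) * log2 n%:R <= tribe_size R d n <= d%:R * log2 n%:R.
Proof.
move=> d0 l1 ln_le; have c0 := ln2_gt0.
have l0 : 0 < log2 n%:R :> R by apply: lt_le_trans l1.
have n0 : 0 < n%:R :> R by apply: lt_le_trans ln_le; rewrite exprn_gt0.
have sizeE : tribe_size R d n = d%:R * (log2 n%:R - log2 (log2 n%:R)).
  by rewrite /tribe_size {1}/log2 ln_div ?posrE // mulrBl.
have ll0 : 0 <= log2 (log2 n%:R) :> R.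
  by apply: divr_ge0; [apply: ln_ge0 | apply: ltW].
have ll : 2 * d%:R * log2 (log2 n%:R) <= log2 n%:R :> R.
  rewrite {1 3}/log2 mulrA ler_pM2r ?invr_gt0 // -natrM mulr_natl -lnXn //.
  by rewrite ler_ln ?posrE // exprn_gt0.
have d1 : 0 <= d%:R :> R by [].
rewrite sizeE; apply/andP; split; last by rewrite ler_wpM2l //; lra.
rewrite mulrBr mulrBl lerD2l lerN2; lra.
Qed.

End Asymptotics.

Local Open Scope nat_scope.

(** A consequence of Bernoulli's inequality
    (1 - 1 / (2 d)) ^ d >= 1 - d / (2 d) = 1 / 2. *)
Lemma bernoulli_half d x y : 0 < d -> (2 * d).-1 * y <= 2 * d * x -> y ^ d <= 2 * x ^ d.
Proof.
move=> d0 le_yx.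
have bern m j : m ^ j.+1 <= m.-1 ^ j.+1 + j.+1 * m ^ j.
  elim: j => [|j IH]; first by rewrite !expn1 expn0; lia.
  case: m IH => [|m] IH; first by rewrite exp0n.
  rewrite /= expnS; apply: leq_trans (leq_mul (leqnn _) IH) _.
  rewrite /= mulnDr mulSn [m * _]mulnC -expnSr.
  have : m ^ j.+1 <= m.+1 ^ j.+1 by rewrite leq_exp2r.
  rewrite mulnCA -expnS; move: (m ^ j.+1) (m.+1 ^ j.+1) (m ^ j.+2) => u v w; lia.
have half : (2 * d) ^ d <= 2 * (2 * d).-1 ^ d.
  have := bern (2 * d) d.-1; rewrite prednK //.
  have : 2 * (d * (2 * d) ^ d.-1) = (2 * d) ^ d by rewrite mulnA -expnS prednK.
  move: ((2 * d) ^ d) (_ * _ ^ d.-1) (_.-1 ^ d) => u v w; lia.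
have p0 : 0 < (2 * d).-1 ^ d by rewrite expn_gt0; apply/orP; left; lia.
rewrite -(leq_pmul2l p0) -expnMn.
apply: (@leq_trans ((2 * d * x) ^ d)); first by rewrite leq_exp2r.
by rewrite expnMn mulnCA mulnA leq_mul2r half orbT.
Qed.

(** The hypothesis of [design_half_covering] holds when k * q is within a factor
    1 + 1 / (4 d) of n and d / k <= 1 / (4 d). *)
Lemma half_covering_bound d k n q : 0 < d -> 4 * d * d <= k ->
  4 * d * n <= (4 * d).+1 * (k * q) -> n ^ d <= 2 * (q * (k - d)) ^ d.
Proof.
move=> d0 le_k le_n; apply: bernoulli_half => //.
have le_dk : d <= k by nia.
have E1 : (4 * d).-1 * k <= 4 * d * (k - d) by rewrite mulnBr; nia.
have E2 : (4 * d).-1 * n <= (4 * d).+1 * (q * (k - d)).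
  rewrite -(leq_pmul2l (_ : 0 < 4 * d)); last by lia.
  have : (4 * d).-1 * (4 * d * n) <= (4 * d).-1 * ((4 * d).+1 * (k * q)).
    by rewrite leq_mul2l le_n orbT.
  have : (4 * d).+1 * q * ((4 * d).-1 * k) <= (4 * d).+1 * q * (4 * d * (k - d)).
    by rewrite leq_mul2l E1 orbT.
  move: (4 * d) (k - d) => u v; lia.
move: E2; move: (q * (k - d)) => v.
nia.
Qed.

Local Open Scope ring_scope.

(** * Hypertribe functions with small joint influences *)

Lemma exists_hypertribe (R : realType) (d : nat) : (2 <= d)%N ->
  exists C : R, 0 < C /\ exists n0 : nat, forall n, in_index_set R d n0 n ->
    exists F : {set {set 'I_n}}, is_tribe_family R d F /\
      forall I : {set 'I_n}, #|I| = d ->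
        JInf I (hypertribe R F) <=
          C * weight_ge d (hypertribe R F) * (log2 n%:R / n%:R) ^+ d.
Proof.
move=> d2; have d0 : (0 < d)%N by apply: ltnW.
have [j2 j3] : (2 <= 2 * d)%N /\ (3 <= 2 * d)%N by lia.
have ge_d k : (4 * d * d <= k)%N -> (1 < k)%N /\ (d <= k)%N.
  by move=> le_k; split; apply: leq_trans le_k; nia.
have le_double v m : (4 * d * m <= (4 * d).+1 * v)%N -> (m <= 2 * v)%N.
  move=> h; rewrite -(leq_pmul2l (_ : 0 < 4 * d)%N); last by lia.
  apply: leq_trans h _; rewrite mulnA leq_mul2r; lia.
have dR2 : 2 <= d%:R :> R by rewrite ler_nat.
(* K is the constant of the bound on the joint influences, and c is a lower bound
   on the expected number of satisfied tribes *)
have [K [K0 KE]] : exists K : R, 0 < K /\ K = loss R d ^+ d.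
  by exists (loss R d ^+ d); rewrite !exprn_gt0.
have [c [c0 cE]] : exists c : R, 0 < c /\ c = (2 * d%:R)^-1 ^+ d.
  by exists ((2 * d%:R)^-1 ^+ d); rewrite exprn_gt0 // invr_gt0; lra.
have [M0 smooth] := @smooth_approx (4 * d) ltac:(lia).
have M1 : 0 <= K ^+ 2 * d%:R * 2 / c.
  by rewrite !mulr_ge0 ?invr_ge0 ?exprn_ge0 // ltW.
have M2 : 0 <= M0%:R * d%:R ^+ 3 :> R by rewrite mulr_ge0.
have M3 : 16 <= (4 * d * d)%:R :> R by rewrite (ler_nat R 16); nia.
have [M [Md MM0 MK]] : exists M : R, [/\ (4 * d * d)%:R <= M,
    M0%:R * d%:R ^+ 3 <= M & K ^+ 2 * d%:R * 2 / c <= M].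
  exists ((4 * d * d)%:R + M0%:R * d%:R ^+ 3 + K ^+ 2 * d%:R * 2 / c).
  move: (4 * d * d)%:R (M0%:R * d%:R ^+ 3) (K ^+ 2 * d%:R * 2 / c) M1 M2 M3.
  by move=> u v w hw hv hu; split; lra.
have M16 : 1 <= M by apply: le_trans (le_trans M3 Md); rewrite (ler_nat R 1 16).
have [n0 growth] := log2_growth M (2 * d).
exists (K * 2 / c); split; first by rewrite !mulr_gt0 ?invr_gt0.
exists n0 => n [/growth[]]; set l : R := log2 n%:R => Ml Mln size_int.
have l1 : 1 <= l := le_trans M16 Ml.
have l0 : 0 < l by lra.
(* n dominates the monomials in log2 n that occur below, such as those that bound
   k ^ 2 and k ^ 3 *)
have small (a : R) j : 0 <= a -> a <= M -> (j <= 2 * d)%N -> a * l ^+ j <= n%:R.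
  move=> a0 aM lej; apply: le_trans Mln; apply: ler_pM; rewrite ?exprn_ge0 ?(ltW l0) //.
  by rewrite ler_weXn2l.
have n_gt0 : 0 < n%:R :> R.
  have := small 1 0 ler01; rewrite expr0 mulr1 => h.
  exact: lt_le_trans (h M16 (leq0n _)).
have lpow : l ^+ (2 * d) <= n%:R.
  by rewrite -[leLHS]mul1r; apply: small ler01 M16 _.
have /andP[k_ge k_le] := tribe_size_bounds d0 l1 lpow.
rewrite -/l in k_ge k_le.
have [k kE] : exists k : nat, k%:R = tribe_size R d n.
  have pos : 0 <= tribe_size R d n by apply: le_trans k_ge; rewrite mulr_ge0 //; lra.
  have : tribe_size R d n \is a Num.nat by rewrite natrEint size_int.
  by move=> /natrP[k e]; exists k.
rewrite -kE in k_ge k_le.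
have k_ge' : 3 / 2 * l <= k%:R by apply: le_trans k_ge; rewrite ler_wpM2r //; lra.
have k_big : (4 * d * d <= k)%N.
  rewrite -(ler_nat R).
  by apply: le_trans Md (le_trans Ml (le_trans _ k_ge')); lra.
have kR0 : 0 < k%:R :> R by lra.
have k0 : (0 < k)%N by rewrite -(ltr0n R).
have dl0 : 0 <= d%:R * l by rewrite mulr_ge0 // ltW.
have Mk : (M0 * k ^ 3 <= n)%N.
  rewrite -(ler_nat R) natrM natrX.
  apply: (@le_trans _ _ (M0%:R * d%:R ^+ 3 * l ^+ 3)).
    by rewrite -mulrA -exprMn ler_wpM2l // lerXn2r ?nnegrE ?(ltW kR0).
  exact: small M2 MM0 j3.
have k_sqrt : k%:R <= 2^-1 * Num.sqrt (n%:R : R).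
  suff : 2 * k%:R <= Num.sqrt (n%:R : R) by move=> h; lra.
  rewrite -(ger0_norm (_ : 0 <= 2 * k%:R :> R)) ?mulr_ge0 // -sqrtr_sqr ler_sqrt //.
  apply: (@le_trans _ _ ((4 * d * d)%:R * l ^+ 2)).
    rewrite exprMn (_ : (4 * d * d)%:R * _ = 2 ^+ 2 * (d%:R * l) ^+ 2); last first.
      by rewrite !natrM; ring.
    by rewrite ler_wpM2l ?exprn_ge0 // lerXn2r ?nnegrE ?(ltW kR0).
  exact: small (ler0n _ _) Md j2.
have [a [b [ka kb le_n ge_n]]] := smooth k n k0 Mk.
have [k1 dk] := ge_d k k_big.
have [F des] := exists_partial_design k1 dk ka kb le_n.
move: (2 ^ a * 3 ^ b)%N F des le_n ge_n => q F des le_n ge_n.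
have Ld := tribe_size_pow n_gt0 l0 kE; rewrite -/l in Ld.
clearbody l; set L := l / n%:R in Ld *.
have L0 : 0 < L by rewrite divr_gt0.
(* q * L =: theta lies between 1 / (2 d) and 1 / (d - 1 / 2), since k is between
   (d - 1 / 2) log2 n and d log2 n *)
have theta_le : q%:R * L * k%:R <= l.
  rewrite /L mulrA mulrAC ler_pdivrMr // mulrAC -natrM mulrC ler_wpM2l ?(ltW l0) //.
  by rewrite ler_nat mulnC.
have theta_ge : (2 * d%:R)^-1 <= q%:R * L.
  rewrite -[leLHS]mul1r ler_pdivrMr; last by lra.
  rewrite /L mulrA mulrAC ler_pdivlMr // mul1r.
  have : n%:R <= 2 * (k%:R * q%:R) :> R.
    by rewrite -natrM -natrM ler_nat le_double.
  move=> /le_trans; apply.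
  have : q%:R * k%:R <= q%:R * (d%:R * l) :> R by rewrite ler_wpM2l.
  by move=> h; lra.
have theta0 : 0 <= q%:R * L by rewrite mulr_ge0 // ltW.
have theta_small : (d%:R - 2^-1) * (q%:R * L) <= 1.
  rewrite -(ler_pM2r l0) mul1r; apply: le_trans theta_le.
  by rewrite mulrAC [leRHS]mulrC ler_wpM2r.
have theta1 : q%:R * L <= 1 by nra.
(* for d = 2 the bound on theta gives (4 / 3) ^ 2, for d > 2 it gives 2 theta < 1 *)
have theta2 : (2 * (q%:R * L)) ^+ d <= 2.
  move: (d2); rewrite leq_eqVlt => /orP[/eqP dE|d3].
    by move: theta_small; rewrite -dE; move: (q%:R * L) theta0 => t t0 ht; nra.
  have d3R : 3 <= d%:R :> R by rewrite (ler_nat R 3).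
  have : 2 * (q%:R * L) <= 1 by nra.
  move=> h; apply: le_trans (exprn_ile1 _ _ _) _ => //; first by lra.
  lra.
have nL : n%:R * L ^+ 2 = l ^+ 2 / n%:R.
  by rewrite /L; field; rewrite gt_eqF.
have nL_le : K ^+ 2 * d%:R * (n%:R * L ^+ 2) <= c / 2.
  rewrite nL (_ : _ * _ = K ^+ 2 * d%:R * 2 / c * l ^+ 2 / n%:R * (c / 2)); last first.
    by field; rewrite !gt_eqF.
  have c2 : 0 <= c / 2 by rewrite divr_ge0 // ltW.
  rewrite ler_piMl // ler_pdivrMr // mul1r.
  exact: small M1 MK j2.
have nL1 : n%:R * L ^+ 2 <= 1.
  rewrite nL ler_pdivrMr // mul1r -[leLHS]mul1r; exact: small ler01 M16 j2.
have JInf_le (J : {set 'I_n}) : (#|J| <= d)%N ->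
    JInf J (hypertribe R F) <= K * L ^+ #|J|.
  by rewrite KE; apply: JInf_hypertribe_le des L0 Ld theta1 _.
exists F; split.
  exists k; split; [exact: kE|exact: k_sqrt|by case: des| |].
    by apply: (design_half_covering des); apply: half_covering_bound d0 k_big ge_n.
  by move=> I cardI; apply: design_le1 des _ cardI.
move=> I cardI.
have weight : c / 2 <= weight_ge d (hypertribe R F).
  apply: le_trans (weight_hypertribe_ge des L0 Ld d2 theta2 (ltW K0) nL1 _); last first.
    by move=> J /ltnW; apply: JInf_le.
  have : c <= (q%:R * L) ^+ d.
    by rewrite cE lerXn2r // nnegrE // invr_ge0; lra.
  by move=> h; lra.
apply: le_trans (JInf_le I _) _; first by rewrite cardI.
rewrite cardI ler_wpM2r ?exprn_ge0 ?(ltW L0) //.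
apply: le_trans (ler_wpM2l _ weight); last by rewrite !mulr_ge0 ?invr_ge0 // ltW.
by rewrite le_eqVlt; apply/orP; left; apply/eqP; field; rewrite gt_eqF.
Qed.

Theorem theorem1p6 (R : realType) (d : nat) (hd : (2 <= d)%N) :
  exists C : R, 0 < C /\
  exists (n0 : nat) (H : forall n : nat, cube n -> R),
    (forall n : nat, in_index_set R d n0 n -> is_hypertribe_function d (H n)) /\
    (forall a : nat, (0 < a)%N -> (n0 <= 2 ^ (2 ^ a))%N ->
       in_index_set R d n0 (2 ^ (2 ^ a))) /\
    (forall n : nat, in_index_set R d n0 n ->
       forall I : {set 'I_n}, #|I| = d ->
         Inf I (H n) <= JInf I (H n) /\
         JInf I (H n) <= C * weight_ge d (H n) * (log2 (n%:R : R) / n%:R) ^+ d).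
Proof.
have [C [C0 [n0 exF]]] := exists_hypertribe R hd.
exists C; split=> //; exists n0.
pose P n (F : {set {set 'I_n}}) := is_tribe_family R d F /\
  forall I : {set 'I_n}, #|I| = d -> JInf I (hypertribe R F) <=
    C * weight_ge d (hypertribe R F) * (log2 n%:R / n%:R) ^+ d.
have tribes n : exists F : {set {set 'I_n}}, in_index_set R d n0 n -> P n F.
  (* off the index set the function is irrelevant *)
  have [/exF[F PF]|nin] := pselect (in_index_set R d n0 n); first by exists F.
  by exists set0.
pose F n := sval (cid (tribes n)).
have FP n : in_index_set R d n0 n -> P n (F n) by exact: svalP (cid (tribes n)).
exists (fun n => hypertribe R (F n)); split; last split.
- by move=> n /FP[famF _]; exists (F n).
- move=> a a0 le_n; split=> //.
  have ln2 : ln 2 != 0 :> R by rewrite gt_eqF // ln2_gt0.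
  have log2X m : log2 (2 ^+ m) = m%:R :> R.
    by rewrite /log2 lnXn // -[ln 2 *+ m]mulr_natl mulfK.
  have le_a : (a <= 2 ^ a)%N by rewrite ltnW // ltn_expl.
  rewrite /tribe_size natrX log2X natrX -expfB_cond ?log2X.
    by rewrite rpredM // natr_int.
  by rewrite pnatr_eq0.
move=> n /FP[_ leF] I cardI; split; last exact: leF.
by apply: Inf_le_JInf => x; apply: normr_hypertribe.
Qed.
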